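(* For the Petersen graph $P$, $pn(\mathcal{E}_{c}(P))=3$.
   Context: A book embedding of a graph consists of a linear order of its vertices (along the spine) together with an assignment of each edge to one of finitely many pages, such that no two edges assigned to the same page cross, where edges $ab$ and $cd$ cross iff their endpoints alternate in the linear order. The pagenumber $pn(G)$ is the minimum number of pages over all book embeddings of $G$. For a graph $G$, the complete expansion graph $\mathcal{E}_{c}(G)$ is the graph with vertex set $\{(v,e) : v\in V(G),\ e\in E(G),\ v \text{ is incident with } e\}$ and edge set $E_1\cup E_2$, where $E_1=\{(v,e)(v,f) : v\in V(G),\ e\neq f \in E(G) \text{ both incident with } v\}$ and $E_2=\{(v,e)(w,e) : e=vw\in E(G)\}$ (each vertex $v$ is replaced by a complete graph $K_{d_G(v)}$, and each edge $vw$ of $G$ becomes one edge joining these complete graphs). *)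

(* Defs.v *)
From mathcomp Require Import all_boot.

Set Implicit Arguments.
Unset Strict Implicit.
Unset Printing Implicit Defensive.

Record sgraph := SGraph {
  vertex :> finType;
  adj : rel vertex;
  adj_sym : symmetric adj;
  adj_irr : irreflexive adj
}.

(* An edge is the two-element set of its endpoints. *)
Definition is_edge (G : sgraph) (e : {set G}) : bool :=
  [exists x, exists y, adj x y && (e == [set x; y])].

Definition edge (G : sgraph) : finType := {e : {set G} | is_edge e}.

(* A linear order of the vertices is given by an injective map [pos] sending
   each vertex to its place on the spine. *)
Section BookEmbedding.
Variables (G : sgraph) (pos : {ffun G -> 'I_#|G|}).

Definition alternate (e f : {set G}) : bool :=
  [exists a, exists b, exists c, exists d,
    [&& e == [set a; b], f == [set c; d] &
        [&& pos a < pos c, pos c < pos b & pos b < pos d]]].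

Definition cross (e f : edge G) : bool :=
  alternate (val e) (val f) || alternate (val f) (val e).

Definition book_embedding (k : nat) (page : {ffun edge G -> 'I_k}) : bool :=
  injectiveb pos &&
  [forall e, forall f, (e != f) && (page e == page f) ==> ~~ cross e f].

End BookEmbedding.

Definition book_embeddable (G : sgraph) (k : nat) : bool :=
  [exists pos : {ffun G -> 'I_#|G|}, exists page : {ffun edge G -> 'I_k},
    book_embedding pos page].

Lemma book_embeddable_ex (G : sgraph) : exists k, book_embeddable G k.
Proof.
exists #|edge G|; apply/existsP; exists [ffun x => enum_rank x].
apply/existsP; exists [ffun e => enum_rank e]; apply/andP; split.
  by apply/injectiveP => x y; rewrite !ffunE => /enum_rank_inj.
apply/forallP => e; apply/forallP => f; apply/implyP => /andP[ne].
by rewrite !ffunE => /eqP/enum_rank_inj ef; rewrite ef eqxx in ne.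
Qed.

Definition pagenumber (G : sgraph) : nat := ex_minn (book_embeddable_ex G).

Section CompleteExpansion.
Variable G : sgraph.

Definition incidence : finType := {p : G * edge G | p.1 \in val p.2}.

Definition expansion_adj (p q : incidence) : bool :=
  let: (v, e) := val p in
  let: (w, f) := val q in
  ((v == w) && (e != f)) || ((e == f) && (val e == [set v; w])).

Lemma expansion_adj_sym : symmetric expansion_adj.
Proof.
move=> [[v e] ve] [[w f] wf]; rewrite /expansion_adj /=.
rewrite (eq_sym w v) (eq_sym f e) setUC.
by case: (e =P f) => // ->.
Qed.

Lemma expansion_adj_irr : irreflexive expansion_adj.
Proof.
move=> [[v e] ve]; rewrite /expansion_adj /= !eqxx /= setUid.
apply/negP => /eqP ev; have /existsP[x /existsP[y /andP[xy /eqP exy]]] := valP e.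
have: x \in [set v] by rewrite -ev exy set21.
have: y \in [set v] by rewrite -ev exy set22.
by rewrite !inE => /eqP yv /eqP xv; rewrite xv yv adj_irr in xy.
Qed.

Definition complete_expansion : sgraph :=
  SGraph expansion_adj_sym expansion_adj_irr.

End CompleteExpansion.

(* The Petersen graph drawn as the outer 5-cycle [(false, i)], the inner
   pentagram [(true, i)] and the five spokes; indices are added modulo 5. *)
Definition petersen_adj (x y : bool * 'I_5) : bool :=
  match x, y with
  | (false, i), (false, j) => (j == i + 1 %[mod 5]) || (i == j + 1 %[mod 5])
  | (true, i), (true, j) => (j == i + 2 %[mod 5]) || (i == j + 2 %[mod 5])
  | (_, i), (_, j) => i == j
  end.

Lemma petersen_adj_sym : symmetric petersen_adj.
Proof. by move=> [[] i] [[] j] /=; rewrite 1?orbC // eq_sym. Qed.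

Lemma petersen_adj_irr : irreflexive petersen_adj.
Proof. by move=> [[] [[|[|[|[|[]]]]] ?]]. Qed.

Definition petersen : sgraph := SGraph petersen_adj_sym petersen_adj_irr.

(* Main.v *)
(* Write x_uv for [pos u < pos v], as a bit. The disjoint chords ab and cd
   alternate on the spine exactly when x_ac + x_ad + x_bc + x_bd is odd, a linear
   expression in the comparisons. Summed over the pairs of edges on
   vertex-disjoint paths of a subdivided K_{3,3}, it is odd for every linear order.
   In a 2-page embedding each alternating pair has page bits of sum 1, so the same
   sum is the sum over edges e of (page bit of e) times the number of alternations
   of e with the edges on the paths disjoint from its own. These edges form a cycle,
   hence that number is even: a contradiction. The expansion of the Petersen graph
   contains a subdivided K_{3,3}, and an explicit layout gives three pages. *)
Require Import Defs.
From mathcomp Require Import all_boot zify.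

Set Implicit Arguments.
Unset Strict Implicit.
Unset Printing Implicit Defensive.

Lemma set2_inj (T : finType) (a b c d : T) :
  [set a; b] = [set c; d] -> (a = c /\ b = d) \/ (a = d /\ b = c).
Proof.
move=> /setP E; move: (E a) (E b) (E c) (E d); rewrite !inE !eqxx /= !orbT.
move=> /esym/orP[]/eqP-> /esym/orP[]/eqP->; rewrite ?eqxx ?orbb; auto.
- by rewrite !(eq_sym d) => _ /eqP->; auto.
- by rewrite !(eq_sym c) => /eqP->; auto.
Qed.

(** * Book embeddings as numeric layouts *)

Section Layout.
Variable G : sgraph.

Lemma is_edgeP (e : {set G}) :
  reflect (exists x y, adj x y /\ e = [set x; y]) (is_edge e).
Proof.
apply: (iffP existsP) => [[x /existsP[y /andP[xy /eqP]]]|[x [y [xy ->]]]].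
  by exists x, y.
by exists x; apply/existsP; exists y; rewrite xy eqxx.
Qed.

Lemma alternateP (pos : {ffun G -> 'I_#|G|}) (e f : {set G}) :
  reflect (exists a b c d, [/\ e = [set a; b], f = [set c; d] &
             [&& pos a < pos c, pos c < pos b & pos b < pos d]])
          (alternate pos e f).
Proof.
apply: (iffP existsP) => [[a /existsP[b /existsP[c /existsP[d]]]]|].
  by case/and3P=> /eqP ? /eqP ? ?; exists a, b, c, d.
move=> [a [b [c [d [-> -> lt]]]]].
exists a; apply/existsP; exists b; apply/existsP; exists c.
by apply/existsP; exists d; rewrite !eqxx.
Qed.

(** Any injective positions will do, since only their order matters. One alternation pattern
    suffices because the hypothesis ranges over both orders of the two edges and of the ends of
    each. *)
Lemma book_embeddable_layout (k : nat) (pos : G -> nat) (page : G -> G -> nat) :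
    injective pos -> (forall a b, page a b = page b a) ->
    (forall a b, adj a b -> page a b < k) ->
    (forall a b c d, adj a b -> adj c d -> page a b = page c d ->
       ~~ [&& pos a < pos c, pos c < pos b & pos b < pos d]) ->
  book_embeddable G k.
Proof.
move=> pos_inj page_sym page_lt nocross.
have ends (e : edge G) : exists xy : G * G,
    adj xy.1 xy.2 && (val e == [set xy.1; xy.2]).
  have /is_edgeP[x [y [xy ->]]] := valP e.
  by exists (x, y); rewrite xy eqxx.
pose end_ e := xchoose (ends e).
have end_adj e : adj (end_ e).1 (end_ e).2.
  by have /andP[] := xchooseP (ends e).
have end_val e : val e = [set (end_ e).1; (end_ e).2].
  by have /andP[_ /eqP] := xchooseP (ends e).
have end_page e a b : val e = [set a; b] ->
    adj a b /\ page a b = page (end_ e).1 (end_ e).2.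
  rewrite end_val => /set2_inj[] [<- <-] //.
  by rewrite adj_sym page_sym.
(* Counting the vertices placed before [x] squeezes arbitrary positions into ['I_#|G|] without
   changing their order. *)
pose below x := [set y | pos y < pos x].
have below_lt x : #|below x| < #|G|.
  rewrite -cardsT; apply/proper_card/properP; split; first exact: subsetT.
  by exists x; rewrite !inE // ltnn.
pose rank := [ffun x => Ordinal (below_lt x)].
have rank_mono x y : (rank x < rank y) = (pos x < pos y).
  rewrite !ffunE /=; case: (ltnP (pos x) (pos y)) => xy.
    apply/proper_card/properP; split; last by exists x; rewrite !inE ?ltnn.
    by apply/subsetP => z; rewrite !inE => /ltn_trans; apply.
  apply/negbTE; rewrite -leqNgt; apply/subset_leq_card/subsetP => z.
  by rewrite !inE => /leq_trans; apply.
apply/existsP; exists rank; apply/existsP.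
exists [ffun e => Ordinal (page_lt _ _ (end_adj e))].
apply/andP; split.
  apply/injectiveP => x y xy; apply: pos_inj; apply/eqP.
  by rewrite eqn_leq ![_ (pos _) (pos _)]leqNgt -!rank_mono xy ltnn.
apply/forallP => e; apply/forallP => f; apply/implyP => /andP[_].
rewrite !ffunE => /eqP[pe].
have noalt e1 f1 : page (end_ e1).1 (end_ e1).2 = page (end_ f1).1 (end_ f1).2 ->
    alternate rank (val e1) (val f1) = false.
  move=> p1; case: alternateP => // -[a [b [c [d [eab fcd]]]]].
  have [ab pab] := end_page _ _ _ eab; have [cd pcd] := end_page _ _ _ fcd.
  by rewrite !rank_mono (negbTE (nocross _ _ _ _ ab cd _)) // pab pcd.
by rewrite /cross !noalt.
Qed.

Lemma layout_of_book_embeddable (k : nat) :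
  book_embeddable G k ->
  exists (pos : G -> nat) (page : G -> G -> nat),
  [/\ injective pos, forall a b, page a b = page b a,
      forall a b, adj a b -> page a b < k &
      forall a b c d, adj a b -> adj c d -> page a b = page c d ->
        ~~ [&& pos a < pos c, pos c < pos b & pos b < pos d]].
Proof.
move=> /existsP[pos /existsP[page /andP[/injectiveP pos_inj /forallP nocross]]].
pose pg a b : nat := if insub [set a; b] is Some e then page e else 0.
have pgE a b (ab : adj a b) :
    exists2 e : edge G, val e = [set a; b] & pg a b = page e.
  have eab : is_edge [set a; b] by apply/is_edgeP; exists a, b.
  by exists (Sub [set a; b] eab); rewrite // /pg insubT.
exists (fun x => pos x : nat), pg; split.
- by move=> x y /ord_inj/pos_inj.
- by move=> a b; rewrite /pg setUC.
- by move=> a b /pgE[e _ ->].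
move=> a b c d /pgE[e ve ->] /pgE[f vf ->] /ord_inj pe.
apply/negP => lt.
have /forallP/(_ f)/implyP := nocross e; rewrite pe eqxx andbT.
(* [book_embedding] constrains distinct edges only; the strict chain in [lt] has four different
   places, so the edges differ. *)
have ef : e != f.
  apply/eqP => ef; move: lt; have := ve; rewrite ef vf.
  by case/set2_inj => [] [-> ->]; lia.
by move=> /(_ ef) /norP[/alternateP[]]; exists a, b, c, d.
Qed.

End Layout.

(** * Vertices of the expansion as directed edges *)

Section Darts.
Variable G : sgraph.

(** A vertex (v, e) of the expansion is read as a dart, the edge e directed away from v, with this
    as its head. The default is never returned, since e has a second end. *)
Definition opposite (p : incidence G) : G :=
  odflt (val p).1 [pick w | val (val p).2 == [set (val p).1; w]].

Lemma oppositeP (p : incidence G) :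
  val (val p).2 = [set (val p).1; opposite p] /\ adj (val p).1 (opposite p).
Proof.
case: p => [[v e] /= ve]; rewrite /opposite /=.
have /is_edgeP[x [y [xy exy]]] := valP e.
case: pickP => [w /eqP ew | none] /=.
  split=> //; move: ew; rewrite exy => /set2_inj[] [<- <-] //.
  by rewrite adj_sym.
move: ve; rewrite /= exy !inE => /orP[]/eqP vE.
  by have := none y; rewrite vE exy eqxx.
by have := none x; rewrite vE exy setUC eqxx.
Qed.

Lemma dart_inj : injective (fun p : incidence G => ((val p).1, opposite p)).
Proof.
move=> p q pq.
have v1 : (val p).1 = (val q).1 := congr1 fst pq.
have o1 : opposite p = opposite q := congr1 snd pq.
have e1 : (val p).2 = (val q).2.
  by apply: val_inj; rewrite (oppositeP p).1 (oppositeP q).1 v1 o1.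
by apply: val_inj; rewrite [LHS]surjective_pairing [RHS]surjective_pairing v1 e1.
Qed.

Lemma dart_surj (u v : G) :
  adj u v -> exists p : incidence G, (val p).1 = u /\ opposite p = v.
Proof.
move=> uv.
have euv : is_edge [set u; v] by apply/is_edgeP; exists u, v.
have inc : u \in val (Sub [set u; v] euv : edge G) by rewrite /= set21.
exists (Sub (u, Sub [set u; v] euv : edge G) inc); split=> //.
have [] := oppositeP (Sub (u, Sub [set u; v] euv : edge G) inc).
by move=> /= /set2_inj[[]|[<- <-]].
Qed.

(** Two darts from one vertex lie on different edges exactly when their heads differ, and each edge
    of G joins a dart to its reverse. *)
Lemma expansion_adjE (p q : incidence G) :
  expansion_adj p q =
    ((val p).1 == (val q).1) && (opposite p != opposite q) ||
    ((val p).1 == opposite q) && (opposite p == (val q).1).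
Proof.
have [ep ap] := oppositeP p; have [eq aq] := oppositeP q.
move: ep ap eq aq; rewrite /expansion_adj.
move: (opposite p) (opposite q) => w' z'.
case: (val p) (val q) => [v e] [w f] /= ep ap eq aq.
rewrite -[e == f]val_eqE /= ep eq.
have nvw : v != w' by apply/eqP => E; rewrite E adj_irr in ap.
have nwz : w != z' by apply/eqP => E; rewrite E adj_irr in aq.
case: (v =P w) => [vw|nvw'] /=.
  subst w; rewrite (negbTE nwz) /= [X in _ || _ && X](_ : _ = false) ?andbF ?orbF.
    congr (~~ _); apply/eqP/eqP => [|-> //].
    by case/set2_inj => [[]|[/eqP]] //; rewrite (negbTE nwz).
  apply/eqP => /set2_inj[[_ /eqP]|[_ /eqP]]; rewrite eq_sym (negbTE nvw) //.
apply/andP/andP => [[/eqP /set2_inj E2 _]|[/eqP -> /eqP ->]].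
  by case: E2 => [[/nvw']|[-> ->]].
by split; rewrite // setUC.
Qed.

End Darts.

(** * Sums modulo 2 *)

Lemma big_addb_even (T : eqType) (s : seq T) (g : T -> bool) :
    all (fun q => ~~ odd (count_mem q s)) s ->
  \big[addb/false]_(q <- s) g q = false.
Proof.
move=> /allP even_s; rewrite -big_undup_iterop_count big1_seq // => q /andP[_].
rewrite mem_undup => /even_s; rewrite Monoid.iteropE => evq.
rewrite -[count_mem q s]odd_double_half (negbTE evq) add0n -addnn.
by rewrite iterD; elim: _./2 => //= n; rewrite -iterSr /= addbA addbC; lia.
Qed.

Lemma big_addb_odd (T : Type) (s : seq T) (P : pred T) :
  \big[addb/false]_(q <- s) P q = odd (count P s).
Proof. by elim: s => [|q s IH]; rewrite ?big_nil // big_cons IH /= oddD oddb. Qed.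

Definition sort_pair (q : nat * nat) := (minn q.1 q.2, maxn q.1 q.2).

(** Over the sorted pairs the sum vanishes by [big_addb_even], so only one flip per descending pair
    remains. The parity is thus the same for every linear order. *)
Lemma tournament_parity (x : rel nat) (s : seq (nat * nat)) :
    {in s, forall q, x q.2 q.1 = ~~ x q.1 q.2} ->
    let s' := map sort_pair s in all (fun q => ~~ odd (count_mem q s')) s' ->
  \big[addb/false]_(q <- s) x q.1 q.2 = odd (count (fun q => q.2 < q.1) s).
Proof.
move=> x_anti s' /(big_addb_even (fun q => x q.1 q.2)); rewrite big_map => sum0.
rewrite -big_addb_odd -[RHS]addFb.
rewrite -[X in X (+) _]sum0 -big_split /=.
rewrite big_seq [RHS]big_seq; apply: eq_bigr => -[u v] /x_anti /=.
by rewrite /minn /maxn; case: ltngtP => [||->] //= _;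
  [rewrite addbF | case: (x u v) => -> | case: (x v v)].
Qed.

(* Each page bit is summed against a cycle, which any chord crosses evenly, so
   the parity of the number of alternating pairs does not see the pages. *)
Lemma two_page_parity (I : eqType) (S : seq I) (U alt : rel I) (pg : I -> bool) :
    {in S &, forall e f, U e f -> pg e = pg f -> alt e f = false} ->
    {in S &, forall e f, U e f -> alt e f = alt f e} ->
    {in S &, forall e f, U e f -> ~~ U f e} ->
    {in S, forall e, \big[addb/false]_(f <- S | U e f || U f e) alt e f = false} ->
  \big[addb/false]_(e <- S) \big[addb/false]_(f <- S | U e f) alt e f = false.
Proof.
move=> nocross alt_sym U_anti cycles.
pose sumU (F : I -> I -> bool) :=
  \big[addb/false]_(e <- S) \big[addb/false]_(f <- S | U e f) F e f.
rewrite -[LHS]/(sumU alt).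
(* An alternating pair has different page bits, so exactly one of the two terms carries it. *)
have -> : sumU alt = sumU (fun e f => pg e && alt e f) (+)
                     sumU (fun e f => pg f && alt f e).
  rewrite /sumU -big_split /= big_seq [RHS]big_seq; apply: eq_bigr => e eS.
  rewrite -big_split /= big_seq_cond [RHS]big_seq_cond.
  apply: eq_bigr => f /andP[fS ef].
  rewrite -(alt_sym e f) //; move: (nocross e f eS fS ef).
  by case: (pg e) (pg f) => [] []; case: (alt e f) => // ->.
(* Exchanging the sums puts every page bit on the outer edge; the inner edges are then those related
   to [e] either way. *)
rewrite {2}/sumU (exchange_big_dep xpredT) //= /sumU -big_split /=.
rewrite big_seq big1 // => e eS.
transitivity (pg e && \big[addb/false]_(f <- S | U e f || U f e) alt e f).
  rewrite big_distrr /= big_mkcond [X in _ (+) X]big_mkcond -big_split /=.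
  rewrite [RHS]big_mkcond big_seq [RHS]big_seq; apply: eq_bigr => f fS /=.
  case: (U e f) (U_anti e f eS fS) => [/(_ isT)/negbTE -> | _] /=.
    by rewrite addbF.
  by case: (U f e).
by rewrite cycles // andbF.
Qed.

(** * Numerical model of the expansion of the Petersen graph *)

(* The vertex [(b, i)] of the Petersen graph gets the digit [5 b + i], and the
   vertex of its expansion at the end v of the edge vw the two-digit number [vw]. *)
Definition digit (v : petersen) : nat := 5 * v.1 + v.2.

Lemma digit_lt10 v : digit v < 10.
Proof. by case: v => [[] [i lt]]; rewrite /digit /=; lia. Qed.

Lemma digit_inj : injective digit.
Proof.
move=> [b [i ltb]] [c [j ltc]]; rewrite /digit /= => eq_digit.
have bc : b = c by case: b c eq_digit => [] []; lia.
by subst c; congr pair; apply: val_inj => /=; lia.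
Qed.

Definition number (p : incidence petersen) : nat :=
  10 * digit (val p).1 + digit (opposite p).

Definition number_adj (m n : nat) : bool :=
  if m %/ 10 == n %/ 10 then m %% 10 != n %% 10
  else (m %/ 10 == n %% 10) && (m %% 10 == n %/ 10).

(* The numbers of the vertices of the expansion, in the spine order of a
   3-page embedding. *)
Definition spine : seq nat :=
  [:: 23; 32; 34; 97; 83; 57; 79; 94; 50; 58; 85; 68; 86; 96; 61;
   69; 16; 5; 4; 10; 1; 49; 40; 43; 21; 12; 72; 27; 75; 38].

(* Page 0 carries the edges in neither [page1] nor [page2]. *)
Definition page1 : seq (nat * nat) :=
  [:: (10, 12); (10, 16); (12, 16); (23, 27); (27, 72); (50, 57); (57, 58); (58, 85);
   (69, 96); (83, 85); (83, 86); (96, 97)].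

Definition page2 : seq (nat * nat) :=
  [:: (1, 4); (1, 5); (1, 10); (5, 50); (12, 21); (21, 23); (21, 27); (32, 34);
   (34, 43); (40, 49); (43, 49); (49, 94); (61, 68); (61, 69); (68, 69); (79, 97); (94, 97)].

Definition spine_page (m n : nat) : nat :=
  let q := (minn m n, maxn m n) in
  if q \in page1 then 1 else if q \in page2 then 2 else 0.

(** Each edge is listed in both directions, so the single pattern in [spine_noncrossing], run over
    all pairs, covers every alternation. *)
Definition spine_edges : seq (nat * nat) :=
  [seq q <- [seq (m, n) | m <- spine, n <- spine] | number_adj q.1 q.2].

Definition spine_noncrossing (e f : nat * nat) : bool :=
  (spine_page e.1 e.2 == spine_page f.1 f.2) ==>
  ~~ [&& index e.1 spine < index f.1 spine, index f.1 spine < index e.2 spine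
       & index e.2 spine < index f.2 spine].

(* A subdivision of K_{3,3}, found in the Petersen graph without its vertex 0:
   an edge labelled [(i, j)] lies on the path joining the [i]-th of the branch
   vertices 21, 85, 94 to the [j]-th of the branch vertices 34, 61, 75. *)
Definition k33 : seq (nat * nat * (nat * nat)) :=
  [:: ((21, 23), (0, 0)); ((23, 32), (0, 0)); ((34, 32), (0, 0));
   ((21, 27), (0, 2)); ((27, 72), (0, 2)); ((75, 72), (0, 2));
   ((21, 12), (0, 1)); ((12, 16), (0, 1)); ((61, 16), (0, 1));
   ((34, 38), (1, 0)); ((38, 83), (1, 0)); ((85, 83), (1, 0));
   ((85, 86), (1, 1)); ((86, 68), (1, 1)); ((61, 68), (1, 1));
   ((85, 58), (1, 2)); ((58, 57), (1, 2)); ((75, 57), (1, 2));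
   ((34, 43), (2, 0)); ((43, 49), (2, 0)); ((94, 49), (2, 0));
   ((61, 69), (2, 1)); ((69, 96), (2, 1)); ((94, 96), (2, 1));
   ((94, 97), (2, 2)); ((97, 79), (2, 2)); ((75, 79), (2, 2))].

(** [spine] holds exactly the thirty ordered adjacent pairs, so it doubles as the adjacency
    table. *)
Lemma petersen_adjE u v : petersen_adj u v = (10 * digit u + digit v \in spine).
Proof.
by move: u v => [[] [[|[|[|[|[|//]]]]] lu]] [[] [[|[|[|[|[|//]]]]] lv]].
Qed.

Lemma number_div p : number p %/ 10 = digit (val p).1.
Proof. by rewrite /number; have := digit_lt10 (opposite p); lia. Qed.

Lemma number_mod p : number p %% 10 = digit (opposite p).
Proof. by rewrite /number; have := digit_lt10 (opposite p); lia. Qed.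

Lemma number_inj : injective number.
Proof.
move=> p q pq; apply: dart_inj; congr pair; apply: digit_inj.
  by rewrite -!number_div pq.
by rewrite -!number_mod pq.
Qed.

Lemma number_spine p : number p \in spine.
Proof. by rewrite -petersen_adjE; apply: (oppositeP p).2. Qed.

Lemma number_surj n : n \in spine -> exists p, number p = n.
Proof.
have digitE d : d < 10 -> exists v, digit v = d.
  move=> lt; have lt5 : d %% 5 < 5 by rewrite ltn_mod.
  by exists (5 <= d, Ordinal lt5); rewrite /digit /=; case: leqP; lia.
move=> n_spine; have lt100 : n < 100.
  by move: n n_spine; apply/allP; vm_compute.
have [u uE] : exists u, digit u = n %/ 10 by apply: digitE; lia.
have [v vE] : exists v, digit v = n %% 10 by apply: digitE; rewrite ltn_mod.
have nE : 10 * digit u + digit v = n by lia.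
have [|p [pu pv]] := @dart_surj petersen u v.
  by rewrite /= petersen_adjE nE.
by exists p; rewrite /number pu pv.
Qed.

Lemma number_adjE (p q : complete_expansion petersen) :
  adj p q = number_adj (number p) (number q).
Proof.
rewrite [LHS]expansion_adjE /number_adj !number_div !number_mod.
rewrite !(inj_eq digit_inj); case: eqP => //= eq_pq.
case: eqP => //= _; rewrite eq_pq; case: eqP => // opp.
by have [_] := oppositeP q; rewrite -opp adj_irr.
Qed.

Lemma spine_edgesP (p q : complete_expansion petersen) :
  adj p q -> (number p, number q) \in spine_edges.
Proof.
move=> pq; rewrite mem_filter; apply/andP; split; first by rewrite -number_adjE.
by apply/allpairsP; exists (number p, number q); rewrite !number_spine.
Qed.

(** * Upper bound: three pages suffice *)

Lemma expansion_petersen_3pages : book_embeddable (complete_expansion petersen) 3.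
Proof.
apply: (@book_embeddable_layout (complete_expansion petersen) _
          (fun p => index (number p) spine)
          (fun p q => spine_page (number p) (number q))).
- move=> p q pq; apply: number_inj.
  by rewrite -(nth_index 0 (number_spine p)) pq nth_index ?number_spine.
- by move=> p q; rewrite /spine_page minnC maxnC.
- by move=> p q _; rewrite /spine_page; case: ifP => // _; case: ifP.
move=> a b c d /spine_edgesP ab /spine_edgesP cd /eqP pg.
have : all (fun e => all (spine_noncrossing e) spine_edges) spine_edges.
  by vm_compute.
by move=> /allP/(_ _ ab)/allP/(_ _ cd)/implyP; apply.
Qed.

(** * Lower bound: two pages do not suffice *)

(** Differing in both labels means that the two paths share no branch vertex, hence are disjoint;
    the strict inequality counts each unordered pair once. *)
Definition independent_lt (e f : nat * nat * (nat * nat)) : bool :=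
  (e.2.1 < f.2.1) && (e.2.2 != f.2.2).

Definition endpoint_pairs (e f : nat * nat * (nat * nat)) : seq (nat * nat) :=
  [:: (e.1.1, f.1.1); (e.1.1, f.1.2); (e.1.2, f.1.1); (e.1.2, f.1.2)].

(** A closed test, free of the order, for [tournament_parity]: distinct entries of [spine] give
    antisymmetry for any injective [pos]. *)
Definition parity_check (b : bool) (s : seq (nat * nat)) : bool :=
  let s' := map sort_pair s in
  [&& all (fun q => [&& q.1 \in spine, q.2 \in spine & q.1 != q.2]) s,
      all (fun q => ~~ odd (count_mem q s')) s' &
      odd (count (fun q => q.2 < q.1) s) == b].

Lemma spine_parity (pos : nat -> nat) (b : bool) (s : seq (nat * nat)) :
    {in spine &, injective pos} -> parity_check b s ->
  \big[addb/false]_(q <- s) (pos q.1 < pos q.2) = b.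
Proof.
move=> pos_inj /and3P[/allP s_spine even_s /eqP <-].
apply: (@tournament_parity (fun u v => pos u < pos v)) => // q /s_spine.
move=> /and3P[q1 q2 /eqP ne].
by case: ltngtP => // /(pos_inj _ _ q2 q1) eq_q; case: ne.
Qed.

Lemma k33_not_2pages (pos : nat -> nat) (page : nat -> nat -> nat) :
    {in spine &, injective pos} -> (forall m n, page m n = page n m) ->
    {in spine_edges, forall e, page e.1 e.2 < 2} ->
    {in spine_edges &, forall e f, page e.1 e.2 = page f.1 f.2 ->
       ~~ [&& pos e.1 < pos f.1, pos f.1 < pos e.2 & pos e.2 < pos f.2]} ->
  False.
Proof.
move=> pos_inj page_sym page_lt nocross.
pose alt e f := \big[addb/false]_(q <- endpoint_pairs e f) (pos q.1 < pos q.2).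
pose pg (e : nat * nat * (nat * nat)) := page e.1.1 e.1.2 == 0.
have k33_edges e : e \in k33 ->
    e.1 \in spine_edges /\ (e.1.2, e.1.1) \in spine_edges.
  by move=> eS; apply/andP; move: e eS; apply/allP; vm_compute.
have distinct e f : e \in k33 -> f \in k33 -> independent_lt e f ->
    [/\ pos e.1.1 != pos f.1.1, pos e.1.1 != pos f.1.2,
        pos e.1.2 != pos f.1.1 & pos e.1.2 != pos f.1.2].
  move=> eS fS ef.
  have : all (fun q => [&& q.1 \in spine, q.2 \in spine & q.1 != q.2])
             (endpoint_pairs e f).
    move: ef; apply/implyP; move: f fS; apply/allP.
    by move: e eS; apply/allP; vm_compute.
  have ne u v : [&& u \in spine, v \in spine & u != v] -> pos u != pos v.
    by move=> /and3P[us vs]; apply: contra_neq; apply: pos_inj.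
  by move=> /and5P[? ? ? ? _]; split; apply: ne.
have alt_page : {in k33 &, forall e f,
    independent_lt e f -> pg e = pg f -> alt e f = false}.
  move=> e f eS fS ef pgef.
  have [e1 e2] := k33_edges e eS; have [f1 f2] := k33_edges f fS.
  have {pgef} E : page e.1.1 e.1.2 = page f.1.1 f.1.2.
    move: pgef (page_lt _ e1) (page_lt _ f1); rewrite /pg /=.
    by case: (page e.1.1 _) (page f.1.1 _) => [|[|i]] [|[|j]].
  have E1 : page e.1.2 e.1.1 = page f.1.1 f.1.2 by rewrite page_sym.
  have E2 : page e.1.1 e.1.2 = page f.1.2 f.1.1 by rewrite E page_sym.
  have E3 : page e.1.2 e.1.1 = page f.1.2 f.1.1 by rewrite E1 page_sym.
  (* Both orders of the edges and both directions of each give eight excluded patterns; with the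
     four inequalities they force an even sum. *)
  have := (nocross _ _ e1 f1 E, nocross _ _ e2 f1 E1, nocross _ _ e1 f2 E2,
           nocross _ _ e2 f2 E3).
  have := (nocross _ _ f1 e1 (esym E), nocross _ _ f1 e2 (esym E1),
           nocross _ _ f2 e1 (esym E2), nocross _ _ f2 e2 (esym E3)).
  have [] := distinct e f eS fS ef.
  rewrite /alt /endpoint_pairs !big_cons big_nil /=.
  move=> n1 n2 n3 n4 [[[h1 h2] h3] h4] [[[h5 h6] h7] h8]; lia.
have alt_sym : {in k33 &, forall e f, independent_lt e f -> alt e f = alt f e}.
  move=> e f eS fS /(distinct e f eS fS)[n1 n2 n3 n4].
  rewrite /alt /endpoint_pairs !big_cons !big_nil /=.
  have flip m n : m != n -> (m < n) = ~~ (n < m) by case: ltngtP.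
  rewrite (flip _ _ n1) (flip _ _ n2) (flip _ _ n3) (flip _ _ n4).
  by do 4!case: (_ < _).
have lt_anti : {in k33 &, forall e f, independent_lt e f -> ~~ independent_lt f e}.
  by move=> e f _ _; rewrite /independent_lt; lia.
have cycles : {in k33, forall e, \big[addb/false]_(f <- k33 |
    independent_lt e f || independent_lt f e) alt e f = false}.
  (* The paths disjoint from that of [e] form a cycle; each of its vertices lies on two of its
     edges, so every endpoint comparison with [e] occurs twice. *)
  move=> e eS; rewrite -big_filter /alt.
  rewrite -(big_map (endpoint_pairs e) xpredT (fun s =>
     \big[addb/false]_(q <- s) (pos q.1 < pos q.2))) -big_flatten.
  apply: spine_parity; first exact: pos_inj.
  by move: e eS; apply/allP; vm_compute.
have := two_page_parity alt_page alt_sym lt_anti cycles.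
suff -> : \big[addb/false]_(e <- k33)
    \big[addb/false]_(f <- k33 | independent_lt e f) alt e f = true by [].
(* In the list of all comparisons every pair of vertices occurs evenly, and its odd number of
   descents fixes the sum for every order. *)
pose S e := flatten [seq endpoint_pairs e f | f <- k33 & independent_lt e f].
transitivity (\big[addb/false]_(q <- flatten [seq S e | e <- k33])
                (pos q.1 < pos q.2)).
  rewrite big_flatten big_map; apply: eq_bigr => e _.
  by rewrite big_flatten big_map big_filter.
by apply: spine_parity; [exact: pos_inj | vm_compute].
Qed.

Lemma expansion_petersen_pages_gt2 k :
  book_embeddable (complete_expansion petersen) k -> 2 < k.
Proof.
move=> /layout_of_book_embeddable[pos [page [pos_inj page_sym page_lt nocross]]].
rewrite ltnNge; apply/negP => k2.
(* [p0] is the default of [vtx] off the spine; any entry of [spine] would do in place of 10. *)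
have [p0 _] : exists p, number p = 10 by apply: number_surj.
pose vtx n : complete_expansion petersen := odflt p0 [pick p | number p == n].
have vtxK : {in spine, cancel vtx number}.
  move=> n /number_surj[p pn]; rewrite /vtx.
  by case: pickP => [q /eqP // | /(_ p)]; rewrite pn eqxx.
have edgeP e : e \in spine_edges -> adj (vtx e.1) (vtx e.2).
  rewrite mem_filter number_adjE => /andP[e_adj /allpairsP[[m n] /= [mS nS E]]].
  by move: e_adj; rewrite E /= !vtxK.
apply: (@k33_not_2pages (pos \o vtx) (fun m n => page (vtx m) (vtx n))).
- by move=> m n mS nS /= /pos_inj E; rewrite -(vtxK m) // E vtxK.
- by move=> m n; apply: page_sym.
- by move=> e /edgeP/page_lt/leq_trans; apply.
by move=> e f /edgeP e_adj /edgeP f_adj; apply: nocross.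
Qed.

Theorem theorem3p6 : pagenumber (complete_expansion petersen) = 3.
Proof.
rewrite /pagenumber; case: ex_minnP => k /expansion_petersen_pages_gt2 k3 k_min.
by apply/eqP; rewrite eqn_leq k3 k_min // expansion_petersen_3pages.
Qed.
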